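(* For every positive integer $m$ there exist a positive integer $k$ and positive integers $n_1,n_2,\dots,n_k$ such that $$m=\frac{1}{n_1}+\frac{1}{n_2}+\cdots+\frac{1}{n_k}$$ and $\sum_{i\in I}\frac{1}{n_i}\notin\mathbb{Z}$ for every subset $I$ with $\emptyset\neq I\subsetneq\{1,2,\dots,k\}$. *)

(* Defs.v *)
From mathcomp Require Import all_boot all_order all_algebra.

(* Main.v *)
(** Call a list of positive integers zero-sum-free if no nonempty sublist has an
    integral sum of reciprocals.  Appending fewer than [q] copies of [q] preserves
    this as soon as [q] is coprime to a common multiple [P] of the list.  Appending
    [P] copies of [P + 1] and replacing [P] by [P (P + 1)], starting from the empty
    list and [P = 1], gives after [m] steps a zero-sum-free list with reciprocal
    sum [m - 1 + 1 / P] (Sylvester's sequence).  Appending [P - 2] copies of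
    [P - 1] brings the sum to [m - 1 / (P (P - 1))].  One last unit fraction
    completes it to [m], and by complementation a proper nonempty subfamily with
    integral sum would give one avoiding this last fraction. *)
Require Import Defs.
From mathcomp Require Import all_boot all_order all_algebra.
From mathcomp Require Import ring.
Import GRing.Theory Num.Theory.
Local Open Scope ring_scope.

Definition recip_sum (s : seq nat) : rat := \sum_(x <- s) 1 / x%:R.

Definition zero_sum_free (s : seq nat) : Prop :=
  forall t, subseq t s -> recip_sum t \is a Num.int -> t = [::].

Lemma recip_sum_cat (s t : seq nat) :
  recip_sum (s ++ t) = recip_sum s + recip_sum t.
Proof. by rewrite /recip_sum big_cat. Qed.

Lemma recip_sum_nseq (a q : nat) : recip_sum (nseq a q) = a%:R / q%:R.
Proof. by rewrite /recip_sum big_nseq iter_addr_0 mul1r mulr_natl. Qed.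

Lemma mul_recip_sum_int (P : nat) (s : seq nat) :
  (0 < P)%N -> all (dvdn^~ P) s -> P%:R * recip_sum s \is a Num.int.
Proof.
move=> P_gt0 /allP sP; rewrite /recip_sum mulr_sumr big_seq.
apply: rpred_sum => x /sP /dvdnP [d defP].
have x_neq0 : x%:R != 0 :> rat.
  by rewrite pnatr_eq0; apply: contraTneq P_gt0 => x0; rewrite defP x0 muln0.
by rewrite defP natrM mul1r mulfK // rpred_nat.
Qed.

Lemma natr_div_int (a q : nat) :
  (0 < q)%N -> (a%:R / q%:R : rat) \is a Num.int -> (q %| a)%N.
Proof.
move=> q_gt0 /intrP [z defz].
have q_neq0 : q%:R != 0 :> rat by rewrite pnatr_eq0 -lt0n.
have : (a%:Z)%:~R = (z * q%:Z)%:~R :> rat.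
  by rewrite intrM -defz -!pmulrn divfK.
move/intr_inj => defa.
by apply/dvdnP; exists `|z|%N; rewrite -[LHS]/`|a%:Z|%N defa abszM.
Qed.

Lemma subseq_catP (T : eqType) (t s1 s2 : seq T) :
  subseq t (s1 ++ s2) ->
  exists t1 t2, [/\ t = t1 ++ t2, subseq t1 s1 & subseq t2 s2].
Proof.
case/subseqP=> b sz_b ->.
exists (mask (take (size s1) b) s1), (mask (drop (size s1) b) s2).
split; rewrite ?mask_subseq // -mask_cat ?cat_take_drop //.
by rewrite size_takel // sz_b size_cat leq_addr.
Qed.

(** Multiplying an integral sum by [P] clears every denominator except [q], so [q] divides [P] times
    the number of copies of [q] used. By coprimality it divides that number, which is at most
    [a < q] and hence zero. *)
Lemma zero_sum_free_cat (P q a : nat) (s : seq nat) :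
  (0 < P)%N -> all (dvdn^~ P) s -> zero_sum_free s ->
  coprime q P -> (a < q)%N -> zero_sum_free (s ++ nseq a q).
Proof.
move=> P_gt0 sP s_free co_qP lt_aq t /subseq_catP [t1 [t2 [-> t1s t2q]]].
have q_gt0 : (0 < q)%N by apply: leq_ltn_trans lt_aq.
have /all_pred1P def_t2 : all (pred1 q) t2.
  by apply/allP=> x /(mem_subseq t2q); rewrite mem_nseq => /andP [].
have le_t2a : (size t2 <= a)%N by rewrite -(size_nseq a q) size_subseq.
rewrite recip_sum_cat def_t2 recip_sum_nseq => t_int.
have t1P : all (dvdn^~ P) t1.
  by apply/allP=> x /(mem_subseq t1s) /(allP sP).
have : ((P * size t2)%:R / q%:R : rat) \is a Num.int.
  have -> : (P * size t2)%:R / q%:R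
            = P%:R * (recip_sum t1 + (size t2)%:R / q%:R) - P%:R * recip_sum t1 :> rat.
    by rewrite mulrDr addrC addKr natrM mulrA.
  by apply: rpredB; [apply: rpredM => //; apply: rpred_nat|apply: mul_recip_sum_int].
move/(natr_div_int _ _ q_gt0); rewrite Gauss_dvdr // => q_dvd.
have t2_0 : size t2 = 0%N.
  apply/eqP; rewrite -leqn0 leqNgt; apply/negP => t2_gt0.
  by have := leq_trans (dvdn_leq t2_gt0 q_dvd) le_t2a; rewrite leqNgt lt_aq.
move: t_int; rewrite t2_0 mul0r addr0 cats0.
exact: s_free.
Qed.

(** The bound [m < P] is carried along so that [P] is at least 2 for positive [m], which makes
    [P - 1] a legitimate denominator later. *)
Lemma sylvester_zero_sum_free (m : nat) :
  exists (P : nat) (s : seq nat),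
    [/\ (m < P)%N, all (dvdn^~ P) s, zero_sum_free s
      & recip_sum s = m%:R - 1 + 1 / P%:R].
Proof.
elim: m => [|m [P [s [lt_mP sP s_free sumE]]]].
  exists 1%N, [::]; split=> //; first by case.
  by rewrite /recip_sum big_nil.
have P_gt0 : (0 < P)%N by apply: leq_ltn_trans lt_mP.
exists (P * P.+1)%N, (s ++ nseq P P.+1); split.
- by rewrite (leq_trans _ (leq_pmull _ P_gt0)).
- rewrite all_cat all_nseq dvdn_mull // orbT andbT.
  by apply: sub_all sP => x xP; apply: dvdn_mulr.
- by apply: zero_sum_free_cat sP s_free _ _; rewrite // coprimeSn.
(* The sum grows as required because [1/P - 1/(P+1) = 1/(P(P+1))]. *)
- rewrite recip_sum_cat sumE recip_sum_nseq natrM -!natr1.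
  have P_neq0 : P%:R != 0 :> rat by rewrite pnatr_eq0 -lt0n.
  have P1_neq0 : P%:R + 1 != 0 :> rat by rewrite natr1 pnatr_eq0.
  by field; rewrite ?P_neq0 ?P1_neq0.
Qed.

Lemma exists_zero_sum_free (m : nat) : (0 < m)%N ->
  exists (N : nat) (s : seq nat),
    [/\ (0 < N)%N, all (leq 1) s, zero_sum_free s
      & recip_sum s + 1 / N%:R = m%:R].
Proof.
(* Since [0 < m < P], only [P = p.+2] survives; for [p = 0] no copy of [P - 1 = 1] is appended. *)
move=> m_gt0; have [[|[|p]] [s [lt_mP sP s_free sumE]]] := sylvester_zero_sum_free m.
- by [].
- by case: m m_gt0 lt_mP {sumE}.
exists (p.+2 * p.+1)%N, (s ++ nseq p p.+1); split=> //.
- rewrite all_cat all_nseq orbT andbT.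
  by apply: sub_all sP => x; apply: dvdn_gt0.
- by apply: zero_sum_free_cat sP s_free _ _; rewrite // coprimenS.
- rewrite recip_sum_cat sumE recip_sum_nseq natrM -!natr1.
  have p1_neq0 : p%:R + 1 != 0 :> rat by rewrite natr1 pnatr_eq0.
  have p2_neq0 : p%:R + 1 + 1 != 0 :> rat by rewrite !natr1 pnatr_eq0.
  by field; rewrite ?p1_neq0 ?p2_neq0.
Qed.

(** Index 0 carries the completing denominator [N], so a set avoiding it, enumerated in increasing
    order, reads off a sublist of [s]. *)
Lemma zero_sum_free_set (N : nat) (s : seq nat) (I : {set 'I_(size s).+1}) :
  zero_sum_free s -> ord0 \notin I ->
  \sum_(i in I) (1 / (nth 0%N (N :: s) i)%:R : rat) \is a Num.int -> I = set0.
Proof.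
move=> s_free I0; rewrite -big_enum /=.
rewrite -(big_map (fun i : 'I__ => nth 0%N (N :: s) i) predT (fun x : nat => 1 / x%:R)).
have sub_s : subseq [seq nth 0%N (N :: s) (i : 'I_(size s).+1) | i <- enum I] s.
  (* [enum I] filters the list of all indices; its head [ord0] is discarded, and the remaining
     indices enumerate [s] itself. *)
  rewrite {1}/enum_mem -enumT enum_ordSl /= (negPf I0).
  have def_s : [seq nth 0%N (N :: s) (i : 'I_(size s).+1)
               | i <- [seq lift ord0 i | i <- enum 'I_(size s)]] = s.
    rewrite -map_comp -[RHS](mkseq_nth 0%N) /mkseq -val_enum_ord -map_comp.
    exact: eq_map.
  by rewrite -[X in subseq _ X]def_s map_subseq // filter_subseq.
move/(s_free _ sub_s)/(congr1 size); rewrite size_map -cardE.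
by move/eqP; rewrite cards_eq0 => /eqP.
Qed.

Theorem theorem1p1 (m : nat) (m_gt0 : (0 < m)%N) :
  exists (k : nat) (n : 'I_k -> nat),
    [/\ (0 < k)%N,
        forall i : 'I_k, (0 < n i)%N,
        m%:R = \sum_(i < k) (1 / (n i)%:R) :> rat
      & forall I : {set 'I_k}, I != set0 -> I \proper [set: 'I_k] ->
          \sum_(i in I) (1 / (n i)%:R : rat) \isn't a Num.int].
Proof.
have [N [s [N_gt0 s_gt0 s_free sumE]]] := exists_zero_sum_free m m_gt0.
pose n (i : 'I_(size s).+1) := nth 0%N (N :: s) i.
have sum_n : m%:R = \sum_i (1 / (n i)%:R) :> rat.
  rewrite big_ord_recl -sumE addrC; congr (_ + _).
  by rewrite /recip_sum (big_nth 0%N) big_mkord.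
exists (size s).+1, n; split=> // [i|I I_neq0].
  have /all_nthP -> // : all (leq 1) (N :: s) by rewrite /= N_gt0.
rewrite properT => I_neqT; apply/negP => I_int.
(* Exactly one of [I] and its complement avoids the index of [N], and both have integral sums
   because the total is [m]. *)
have [I0|I0] := boolP (ord0 \in I); last first.
  by rewrite (zero_sum_free_set N s I) ?eqxx in I_neq0.
have : ~: I = set0.
  apply: (zero_sum_free_set N) => //; first by rewrite inE I0.
  have -> : \sum_(i in ~: I) (1 / (nth 0%N (N :: s) i)%:R)
            = m%:R - \sum_(i in I) (1 / (n i)%:R) :> rat.
    rewrite sum_n [in RHS](bigID (mem I)) /= addrAC subrr add0r.
    by apply: eq_bigl => i; rewrite inE.
  by rewrite rpredB ?rpred_nat.
by move/(congr1 (@setC _)); rewrite setCK setC0 => IT; rewrite IT eqxx in I_neqT.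
Qed.
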